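(* Let $\Gamma=(X,R)$ be a bipartite distance-regular graph with diameter $D\ge4$ and valency $k\ge3$, fix $x\in X$, and let $W$ be a thin irreducible $T(x)$-module with endpoint $2$ and local eigenvalue $\eta$ satisfying $\tilde\theta_1<\eta<\tilde\theta_d$. Let $v$ be a nonzero vector in $E^*_2W$. Then $W=Mv$, the vectors $E_1v,E_2v,\dots,E_{D-1}v$ form a basis for $W$, and $E_0v=0$, $E_Dv=0$.
   Context: $\Gamma$ is a finite connected bipartite distance-regular graph with distance $\partial$, intersection numbers $c_i,b_i$ ($c_0=0,b_D=0$). $A_i$ distance matrices, $A=A_1$, $M$ the Bose–Mesner algebra (span of $A_0,\dots,A_D$), eigenvalues $\theta_0=k>\theta_1>\dots>\theta_D$, $E_i$ primitive idempotent for $\theta_i$; $d=\lfloor D/2\rfloor$. $E^*_i$ is diagonal with $(y,y)$-entry $1$ if $\partial(x,y)=i$, else $0$; $T(x)$ is the algebra generated by $A,E^*_0,\dots,E^*_D$; $T$-modules are $T$-invariant subspaces of $V=\mathbb{C}^X$; irreducible, thin ($\dim E^*_iW\le1$ for all $i$), endpoint ($\min\{i:E^*_iW\ne0\}$); the local eigenvalue of a thin irreducible $W$ with endpoint $2$ is the eigenvalue of $E^*_2A_2E^*_2$ on the one-dimensional space $E^*_2W$. $\tilde\theta_1=-1-b_2b_3(\theta_1^2-b_2)^{-1}$, $\tilde\theta_d=-1-b_2b_3(\theta_d^2-b_2)^{-1}$. *)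

(* Defs.v *)
From HB Require Import structures.
From mathcomp Require Import all_boot all_order all_algebra.
From mathcomp Require Import reals.
From mathcomp Require Import complex.

Set Implicit Arguments.
Unset Strict Implicit.
Unset Printing Implicit Defensive.

Import Order.TTheory GRing.Theory Num.Theory.
Local Open Scope ring_scope.
Local Open Scope complex_scope.

(* A finite simple graph is a symmetric irreflexive [e : rel X] on a finType. *)
Section Graph.
Variables (X : finType) (e : rel X).

Definition simple_graph : Prop := symmetric e /\ irreflexive e.

Definition connected_graph : Prop := forall y z : X, connect e y z.

Definition bipartite_graph : Prop :=
  exists Y : {set X}, forall y z, e y z -> (y \in Y) != (z \in Y).

Definition walk_of_length (n : nat) (y z : X) : bool :=
  [exists p : n.-tuple X, path e y p && (last y p == z)].

(* Length of a shortest walk from [y] to [z]; a shortest walk has at most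
   #|X|.-1 steps, and the value is the junk #|X| when there is no walk. *)
Definition dist (y z : X) : nat :=
  find (fun n => walk_of_length n y z) (iota 0 #|X|).

Definition diam : nat := \max_(u : X * X) dist u.1 u.2.

Definition dist_count (i j : nat) (y z : X) : nat :=
  #|[set w | (dist y w == i) && (dist w z == j)]|.

Definition distance_regular : Prop :=
  forall (i j : nat) (y z y' z' : X),
    dist y z = dist y' z' -> dist_count i j y z = dist_count i j y' z'.

(* The intersection number p^h_{ij}, read off an arbitrary pair at distance h
   (the choice is immaterial when [distance_regular] holds). *)
Definition intersection_number (h i j : nat) : nat :=
  if [pick u : X * X | dist u.1 u.2 == h] is Some u
  then dist_count i j u.1 u.2 else 0%N.

Definition bnum (i : nat) : nat := intersection_number i 1 i.+1.

Definition valency : nat := bnum 0.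

End Graph.

(* The space C^X is 'cV[C]_#|X| with coordinates transported along
   [enum_val : 'I_#|X| -> X]; matrices act on the left of column vectors. *)
Section Algebra.
Variables (R : realType) (X : finType) (e : rel X).
Local Notation C := R[i].
Local Notation n := #|X|.

Definition dist_mx (i : nat) : 'M[C]_n :=
  \matrix_(y, z) (dist e (enum_val y) (enum_val z) == i)%:R.

Definition adj_mx : 'M[C]_n := dist_mx 1.

Definition bose_mesner : {vspace 'M[C]_n} :=
  <<[seq dist_mx i | i <- iota 0 (diam e).+1]>>%VS.

Definition eigenvalue_ordering (theta : nat -> R) : Prop :=
  (forall i j, (i < j <= diam e)%N -> theta j < theta i) /\
  (forall t : C, eigenvalue adj_mx t <->
     exists2 i : nat, (i <= diam e)%N & t = (theta i)%:C).

Definition primitive_idempotent (F : 'M[C]_n) : Prop :=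
  [/\ F \in bose_mesner, F != 0, F *m F = F &
      forall G H : 'M[C]_n, G \in bose_mesner -> H \in bose_mesner ->
        G *m G = G -> H *m H = H -> G *m H = 0 -> H *m G = 0 ->
        F = G + H -> G = 0 \/ H = 0].

Definition primitive_idempotent_for (t : R) (F : 'M[C]_n) : Prop :=
  primitive_idempotent F /\ adj_mx *m F = t%:C *: F.

Definition theta_tilde (t : R) : R :=
  - 1 - (bnum e 2)%:R * (bnum e 3)%:R * (t ^+ 2 - (bnum e 2)%:R)^-1.

Definition dual_idem (x : X) (i : nat) : 'M[C]_n :=
  diag_mx (\row_y (dist e x (enum_val y) == i)%:R).

Inductive terwilliger_alg (x : X) : 'M[C]_n -> Prop :=
| Talg_adj : terwilliger_alg x adj_mx
| Talg_dual i : (i <= diam e)%N -> terwilliger_alg x (dual_idem x i)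
| Talg_one : terwilliger_alg x 1%:M
| Talg_lin (a : C) B B' : terwilliger_alg x B -> terwilliger_alg x B' ->
    terwilliger_alg x (a *: B + B')
| Talg_mul B B' : terwilliger_alg x B -> terwilliger_alg x B' ->
    terwilliger_alg x (B *m B').

Implicit Types (W U : {vspace 'cV[C]_n}).

Definition T_module (x : X) W : Prop :=
  forall B, terwilliger_alg x B -> forall w, w \in W -> B *m w \in W.

Definition T_irreducible (x : X) W : Prop :=
  [/\ T_module x W, W != 0%VS &
      forall U, T_module x U -> (U <= W)%VS -> U = 0%VS \/ U = W].

Definition dual_part (x : X) W (i : nat) : {vspace 'cV[C]_n} :=
  (linfun (mulmx (dual_idem x i)) @: W)%VS.

Definition thin (x : X) W : Prop :=
  forall i, (i <= diam e)%N -> (\dim (dual_part x W i) <= 1)%N.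

Definition has_endpoint (x : X) W (r : nat) : Prop :=
  [/\ (r <= diam e)%N, dual_part x W r != 0%VS &
      forall i, (i < r)%N -> dual_part x W i = 0%VS].

(* Meaningful when [dual_part x W 2] is a line, e.g. for W thin with
   endpoint 2; eta is then unique, and real because the matrix is real
   symmetric. *)
Definition local_eigenvalue (x : X) W (eta : R) : Prop :=
  forall u, u \in dual_part x W 2 ->
    (dual_idem x 2 *m dist_mx 2 *m dual_idem x 2) *m u = eta%:C *: u.

Definition bose_mesner_orbit (v : 'cV[C]_n) : {vspace 'cV[C]_n} :=
  (linfun (mulmxr v) @: bose_mesner)%VS.

End Algebra.

(* Main.v *)
Require Import Defs.
From HB Require Import structures.
From mathcomp Require Import all_boot all_order all_algebra.
From mathcomp Require Import zify ring lra.
From mathcomp Require Import reals.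
From mathcomp Require Import complex.

(* Since Jv = 0 and two vertices at distance 2 from x are at distance 0, 2 or
   4, E*_2 E_i v is a multiple of v, the factor being proportional to
   1 + eta u_2 - (1 + eta) u_4, where u_h is the cosine sequence of theta_i.
   This is (1 - u_2) (1 + (1 + eta) (theta_i^2 - b_2) / (b_2 b_3)), which for
   0 < i < D is nonzero: the spectrum is symmetric, so theta_i^2 lies between
   theta_d^2 and theta_1^2.  Hence E_1 v, ..., E_{D-1} v are D - 1 independent
   vectors of Mv, which lies in W because M lies in T(x), while dim W <= D - 1
   because W is thin with endpoint 2.  The eigenvalues k and -k have cosines 1
   and (-1)^h, so E_0 v and E_D v are multiples of the sum of the entries of v,
   which vanishes because E*_0 A_2 v lies in E*_0 W = 0. *)

Set Implicit Arguments.
Unset Strict Implicit.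
Unset Printing Implicit Defensive.

Import Order.TTheory GRing.Theory Num.Theory.
Local Open Scope ring_scope.
Local Open Scope complex_scope.

(** * Distance in connected and in bipartite simple graphs *)

Section Distance.
Variables (X : finType) (e : rel X).

Lemma dist_le_size y p : path e y p -> (dist e y (last y p) <= size p)%N.
Proof.
(* The search defining [dist] stops at #|X|, so a walk at least that long bounds [dist]
   trivially. *)
move=> ep; have [lt_pX|le_Xp] := ltnP (size p) #|X|; last first.
  by apply: leq_trans le_Xp; rewrite -[leqRHS](size_iota 0) find_size.
rewrite leqNgt; apply/negP => /(before_find 0%N).
rewrite nth_iota // add0n => /negbT/existsP; apply; exists (in_tuple p).
by rewrite ep eqxx.
Qed.

Hypothesis e_conn : connected_graph e.

(** A walk shortened to one without repeated vertices has fewer than #|X| steps, so the search in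
    [dist] succeeds and the junk value never occurs. *)
Lemma dist_lt_card y z : (dist e y z < #|X|)%N.
Proof.
rewrite -[ltnRHS](size_iota 0) -has_find; apply/hasP.
have /connectP[p ep ->] := e_conn y z.
case/shortenP: ep => q eq uq _; exists (size q).
  rewrite mem_iota /= add0n cardE.
  exact: uniq_leq_size uq (in1W (mem_enum X)).
by apply/existsP; exists (in_tuple q); rewrite eq eqxx.
Qed.

Lemma dist_path y z :
  exists p, [/\ path e y p, last y p = z & size p = dist e y z].
Proof.
have := dist_lt_card y z; rewrite -[ltnRHS](size_iota 0) -has_find.
move=> /(nth_find 0%N); rewrite nth_iota ?dist_lt_card // add0n.
case/existsP=> p /andP[ep /eqP lp].
by exists p; split; rewrite ?size_tuple.
Qed.

Lemma dist0 y z : (dist e y z == 0%N) = (y == z).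
Proof.
apply/eqP/eqP => [d0|->]; last first.
  by apply/eqP; rewrite -leqn0 (@dist_le_size z [::]).
by have [[|? ?] [_ lp]] := dist_path y z; rewrite d0.
Qed.

Lemma dist_triangle y w z : (dist e y z <= dist e y w + dist e w z)%N.
Proof.
have [p [ep lp <-]] := dist_path y w; have [q [eq <- <-]] := dist_path w z.
by rewrite -size_cat -lp -last_cat dist_le_size // cat_path ep lp.
Qed.

Hypothesis e_simple : simple_graph e.

Lemma dist1 y z : (dist e y z == 1%N) = e y z.
Proof.
apply/idP/idP => [/eqP d1|eyz].
  have [[|w [|? ?]] [//= + lp]] := dist_path y z; rewrite d1 //.
  by rewrite -lp andbT.
have := @dist_le_size y [:: z]; rewrite /= eyz => /(_ isT).
have := dist0 y z; case: (dist e y z) => [/esym/eqP yz|[|]] //.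
by rewrite yz e_simple.2 in eyz.
Qed.

Lemma dist_sym y z : dist e y z = dist e z y.
Proof.
wlog suff le: y z / (dist e y z <= dist e z y)%N.
  by apply/eqP; rewrite eqn_leq !le.
have [p [ep lp <-]] := dist_path z y.
case: p => [|a p] in ep lp *; first by rewrite -lp leqn0 dist0 eqxx.
rewrite -lp -(size_belast z) -size_rev.
(* The reversed walk lists [belast z (a :: p)] backwards and so ends at [z]. *)
have {2}-> : z = last (last z (a :: p)) (rev (belast z (a :: p))).
  by rewrite /= rev_cons last_rcons.
apply: dist_le_size; rewrite rev_path; apply: sub_path ep => u w /=.
by rewrite e_simple.1.
Qed.

Lemma dist_pred y z h : dist e y z = h.+1 -> exists2 w, e y w & dist e w z = h.
Proof.
move=> dyz; have [[|w p] [//= + lp]] := dist_path y z; rewrite dyz //.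
move=> /andP[eyw ep] [sp]; exists w => //.
have := dist_le_size ep; rewrite lp sp => le_h.
have := dist_triangle y w z; move: eyw; rewrite -dist1 => /eqP ->.
by rewrite dyz add1n ltnS => ge_h; apply/eqP; rewrite eqn_leq le_h.
Qed.

Lemma dist_edge y w z : e y w -> (dist e y z <= (dist e w z).+1)%N.
Proof.
by rewrite -dist1 => /eqP d1; have := dist_triangle y w z; rewrite d1.
Qed.

Lemma dist_le_diam y z : (dist e y z <= diam e)%N.
Proof.
exact: (@bigop.leq_bigmax _ (fun u : X * X => dist e u.1 u.2) (y, z)).
Qed.

(** Start from a pair at distance D and move its first vertex towards the second, one edge at a
    time. *)
Lemma dist_attained h (x0 : X) :
  (h <= diam e)%N -> exists y z, dist e y z = h.
Proof.
have gt0 : (0 < #|{: X * X}|)%N by apply/card_gt0P; exists (x0, x0).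
have [[y z] dyz] := @bigop.eq_bigmax _ (fun u : X * X => dist e u.1 u.2) gt0.
move=> /subnK; move: (diam e - h)%N => m; elim: m h => [|m IHm] h.
  by rewrite add0n => ->; exists y, z; exact: esym dyz.
rewrite addSnnS => /IHm[y' [z' /dist_pred[w _ <-]]].
by exists w, z'.
Qed.

Hypothesis e_bip : bipartite_graph e.

(** Every edge changes sides of the bipartition, so the parity of a distance tells whether its ends
    lie on opposite sides. *)
Lemma odd_dist : exists Y : {set X}, forall y z,
  odd (dist e y z) = (y \in Y) (+) (z \in Y).
Proof.
have [Y eY] := e_bip; exists Y => y z.
move dyz: (dist e y z) => h; elim: h y dyz => [|h IHh] y.
  by move=> /eqP; rewrite dist0 => /eqP ->; rewrite addbb.
move=> /dist_pred[w /eY + /IHh] /= => + ->.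
by case: (y \in Y); case: (w \in Y); case: (z \in Y).
Qed.

Lemma odd_distD y w z :
  odd (dist e y z) = odd (dist e y w) (+) odd (dist e w z).
Proof.
have [Y oY] := odd_dist; rewrite !oY.
by case: (y \in Y); case: (w \in Y); case: (z \in Y).
Qed.

End Distance.

(** * Intersection numbers and the three-term recurrence of cosine sequences *)

Section IntersectionNumbers.
Variables (X : finType) (e : rel X).
Hypotheses (e_conn : connected_graph e) (e_simple : simple_graph e).
Hypotheses (e_bip : bipartite_graph e) (e_dr : distance_regular e).

Definition cnum (i : nat) : nat := intersection_number e i 1 i.-1.

Lemma dist_countE i j y z :
  dist_count e i j y z = intersection_number e (dist e y z) i j.
Proof.
rewrite /intersection_number; case: pickP => [u /eqP du|/(_ (y, z))].
  exact: e_dr.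
by rewrite /= eqxx.
Qed.

Lemma sum_edge_dist (K : pzSemiRingType) (f : nat -> K) y z j :
  \sum_(w | e y w && (dist e w z == j)) f (dist e w z) =
  (intersection_number e (dist e y z) 1 j)%:R * f j.
Proof.
rewrite -dist_countE /dist_count mulr_natl.
rewrite (eq_bigr (fun=> f j)) => [|w /andP[_ /eqP -> //]].
by rewrite sumr_const; congr (_ *+ _); apply: eq_card => w;
  rewrite !inE dist1.
Qed.

Lemma edge_sum0 (K : pzSemiRingType) (f : nat -> K) y :
  \sum_(w | e y w) f (dist e w y) = (valency e)%:R * f 1%N.
Proof.
have dyy : dist e y y = 0%N by apply/eqP; rewrite dist0.
have := sum_edge_dist f y y 1%N; rewrite dyy => <-; apply: eq_bigl => w.
by case eyw: (e y w) => //=; rewrite dist1 // e_simple.1 eyw.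
Qed.

(** A neighbour of [y] is at distance h, h+1 or h+2 from [z], and parity excludes h+1; hence there
    is no middle term. *)
Lemma edge_sumS (K : pzSemiRingType) (f : nat -> K) y z h :
  dist e y z = h.+1 ->
  \sum_(w | e y w) f (dist e w z) =
  (cnum h.+1)%:R * f h + (bnum e h.+1)%:R * f h.+2.
Proof.
move=> dyz; have := sum_edge_dist f y z h; have := sum_edge_dist f y z h.+2.
rewrite /cnum /bnum dyz => <- <-.
rewrite (bigID (fun w => dist e w z == h)); congr (_ + _).
apply: eq_bigl => w; case eyw: (e y w) => //=.
have := dist_edge e_conn e_simple z eyw.
have := @dist_edge _ _ e_conn e_simple w y z.
rewrite e_simple.1 => /(_ eyw).
have := odd_distD e_conn e_simple e_bip y w z.
by move: (eyw); rewrite -(dist1 e_conn e_simple) => /eqP ->; rewrite dyz; lia.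
Qed.

Section Positivity.
Variable x : X.

(** For [y], [z] at distance h+1 and [w] the next vertex on a shortest walk from [y] to [z], [w] is
    counted by c_(h+1) at (y, z) and [y] by b_h at (w, z). *)
Lemma bnum_cnum_gt0 h :
  (h < diam e)%N -> (0 < bnum e h)%N /\ (0 < cnum h.+1)%N.
Proof.
case/(dist_attained e_conn e_simple x) => y [z dyz].
have [w eyw dwz] := dist_pred e_conn e_simple dyz.
have := dist_countE 1 h.+1 w z; have := dist_countE 1 h y z.
rewrite /bnum /cnum dwz dyz => <- <-.
split; apply/card_gt0P; [exists y | exists w]; rewrite inE dist1 //.
  by rewrite e_simple.1 eyw dyz eqxx.
by rewrite eyw dwz eqxx.
Qed.

Lemma cnumDbnum h :
  (h < diam e)%N -> (cnum h.+1 + bnum e h.+1 = valency e)%N.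
Proof.
case/(dist_attained e_conn e_simple x) => y [z dyz].
have := edge_sumS (fun=> 1%N) dyz; rewrite (edge_sum0 (fun=> 1%N)).
by rewrite !mulr1 !natn.
Qed.

Lemma cnum1 : (0 < diam e)%N -> cnum 1 = 1%N.
Proof.
case/(dist_attained e_conn e_simple x) => y [z dyz].
have := dist_countE 1 0 y z; rewrite /cnum dyz => <-; apply/eqP/cards1P; exists z.
apply/setP => w; rewrite !inE dist1 // dist0 // andbC.
by case: eqP => //= ->; rewrite -(dist1 e_conn e_simple) dyz.
Qed.

(* A F = t F for the matrix F with entries F y z = f (dist y z). *)
Definition cosine_rec (K : fieldType) (t : K) (f : nat -> K) : Prop :=
  (valency e)%:R * f 1%N = t * f 0%N /\
  forall h, (h < diam e)%N ->
    (cnum h.+1)%:R * f h + (bnum e h.+1)%:R * f h.+2 = t * f h.+1.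

(** The coefficients k and b_h with h < D are nonzero, so the recurrence can be solved upwards from
    [f 0]. *)
Lemma cosine_rec_eq (K : numFieldType) (t : K) (f g : nat -> K) :
  cosine_rec t f -> cosine_rec t g -> f 0%N = g 0%N ->
  forall h, (h <= diam e)%N -> f h = g h.
Proof.
move=> [f1 fS] [g1 gS] fg0 h.
(* The recurrence has order two, so the induction carries two consecutive terms. *)
suff: (h <= diam e)%N -> f h = g h /\ (h.+1 <= diam e -> f h.+1 = g h.+1)%N.
  by move=> fg /fg[].
elim: h => [_|h IHh lthD]; split=> //.
- move=> /bnum_cnum_gt0[k_gt0 _].
  have k_neq0 : (valency e)%:R != 0 :> K by rewrite pnatr_eq0 -lt0n.
  by apply: (mulfI k_neq0); rewrite f1 g1 fg0.
- by have [_ ->] := IHh (ltnW lthD).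
move=> lth1D; have [b_gt0 _] := bnum_cnum_gt0 lth1D.
have b_neq0 : (bnum e h.+1)%:R != 0 :> K by rewrite pnatr_eq0 -lt0n.
have [fgh /(_ lthD) fgh1] := IHh (ltnW lthD).
have := fS h lthD; rewrite fgh1 -(gS h lthD) fgh => /addrI.
exact: mulfI.
Qed.

Lemma cosine_rec_const (K : fieldType) (a : K) :
  cosine_rec (valency e)%:R (fun=> a).
Proof.
by split=> // h lthD; rewrite -mulrDl -natrD cnumDbnum.
Qed.

Lemma cosine_rec_sign (K : fieldType) (a : K) :
  cosine_rec (- (valency e)%:R) (fun h => (-1) ^+ h * a).
Proof.
split=> [|h lthD]; first by rewrite expr0 expr1; ring.
by rewrite -(cnumDbnum lthD) natrD !exprS; ring.
Qed.

(* With u_i = f i / f 0 this is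
   1 + s u_2 - (1 + s) u_4 = (1 - u_2) (1 + (1 + s) (t^2 - b_2) / (b_2 b_3)). *)
Lemma cosine_rec_local (K : numFieldType) (t s : K) (f : nat -> K)
    (b2 := (bnum e 2)%:R : K) (b3 := (bnum e 3)%:R : K) :
  (4 <= diam e)%N -> cosine_rec t f ->
  f 0%N != 0 -> t ^+ 2 != (valency e)%:R ^+ 2 ->
  b2 * b3 + (1 + s) * (t ^+ 2 - b2) != 0 ->
  f 0%N + s * f 2%N - (1 + s) * f 4%N != 0.
Proof.
move=> D4 [f1 fS] f0_neq0 tk st_neq0.
have k_neq0 : (valency e)%:R != 0 :> K.
  by rewrite pnatr_eq0 -lt0n; have [] := @bnum_cnum_gt0 0 (ltn_trans _ D4).
have nz h : (h < 4)%N -> (bnum e h)%:R != 0 :> K.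
  by move=> h4; rewrite pnatr_eq0 -lt0n; case: (@bnum_cnum_gt0 h); lia.
have cE h : (h < 4)%N ->
    (cnum h.+1)%:R = (valency e)%:R - (bnum e h.+1)%:R :> K.
  by move=> h4; rewrite -(@cnumDbnum h) ?natrD ?addrK //; lia.
have b1E : (bnum e 1)%:R = (valency e)%:R - 1 :> K.
  by rewrite -(@cnumDbnum 0) ?cnum1 ?natrD; [ring | lia | lia].
have := fS 0%N; have := fS 1%N; have := fS 2%N.
rewrite !cE //.
have := nz 1%N isT; have := nz 2%N isT; have := nz 3%N isT.
rewrite -/b2 -/b3 b1E; move: (valency e)%:R k_neq0 f1 tk => k k_neq0 f1 tk.
move=> b3_neq0 b2_neq0 k1_neq0 e3 e2 e1.
have f1E : f 1%N = t * f 0%N / k by rewrite -f1; field.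
have f2E : f 2%N = (t * f 1%N - f 0%N) / (k - 1).
  by apply: (canRL (mulfK k1_neq0)); rewrite -e1; [ring | lia].
have f3E : f 3%N = (t * f 2%N - (k - b2) * f 1%N) / b2.
  by apply: (canRL (mulfK b2_neq0)); rewrite -e2; [ring | lia].
have f4E : f 4%N = (t * f 3%N - (k - b3) * f 2%N) / b3.
  by apply: (canRL (mulfK b3_neq0)); rewrite -e3; [ring | lia].
(* The factor (k^2 - t^2) / (k (k - 1)) is 1 - u_2. *)
have -> : f 0%N + s * f 2%N - (1 + s) * f 4%N = f 0%N * (k ^+ 2 - t ^+ 2) *
    (b2 * b3 + (1 + s) * (t ^+ 2 - b2)) / (k * (k - 1) * (b2 * b3)).
  by rewrite f4E f3E f2E f1E; field; apply/and4P.
rewrite mulf_neq0 ?invr_eq0 ?mulf_neq0 //.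
by rewrite subr_eq0 eq_sym.
Qed.

End Positivity.

End IntersectionNumbers.

(** * Independence of eigenvectors with distinct eigenvalues *)

Section Eigenvectors.
Variables (K : fieldType) (n : nat) (A : 'M[K]_n) (I : eqType).
Variables (t : I -> K) (w : I -> 'cV[K]_n).

Lemma span_eigen_stable (s : seq I) u :
  {in s, forall i, A *m w i = t i *: w i} ->
  u \in <<map w s>>%VS -> A *m u \in <<map w s>>%VS.
Proof.
move=> Aw us; rewrite -(lfunE (mulmx A)).
have /subvP : (linfun (mulmx A) @: <<map w s>> <= <<map w s>>)%VS.
  rewrite limg_span; apply/span_subvP => _ /mapP[_ /mapP[i si ->] ->].
  by rewrite lfunE /= Aw // memvZ // memv_span // map_f.
by apply; apply: memv_img.
Qed.

(** Applying A - t_a removes the component along [w a] and multiplies the vector by c - t_a, which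
    is nonzero; induction then applies to the shorter span. *)
Lemma span_eigen_eq0 (s : seq I) c u :
  {in s, forall i, A *m w i = t i *: w i} ->
  u \in <<map w s>>%VS -> A *m u = c *: u -> c \notin map t s -> u = 0.
Proof.
elim: s u => [|a s IHs] u Aw; first by rewrite span_nil memv0 => /eqP.
have {}IHs := IHs _ (sub_in1 (mem_behead (s := a :: s)) Aw).
rewrite /= span_cons => /memv_addP[_ /vlineP[b ->] [u' u's ->]] Au.
rewrite inE negb_or => /andP[ca cs]; apply/eqP.
move: Au; set z := b *: w a + u' => Au.
have /IHs : (c - t a) *: z \in <<map w s>>%VS.
  rewrite scalerBl -Au mulmxDr -scalemxAr Aw ?mem_head //.
  rewrite scalerDr !scalerA (mulrC b) opprD addrACA subrr add0r.
  rewrite memvB ?memvZ // span_eigen_stable // => i si.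
  by rewrite Aw ?inE ?si ?orbT.
rewrite -scalemxAr Au !scalerA mulrC => /(_ erefl cs)/eqP.
by rewrite scaler_eq0 subr_eq0 (negPf ca).
Qed.

Lemma free_eigen (s : seq I) :
  {in s, forall i, A *m w i = t i *: w i} -> {in s, forall i, w i != 0} ->
  uniq (map t s) -> free (map w s).
Proof.
elim: s => [|a s IHs] Aw w0 /=; first by rewrite nil_free.
move=> /andP[ts /IHs free_s]; rewrite free_cons; apply/andP; split.
  apply/negP => /span_eigen_eq0 wa0.
  have /eqP := w0 _ (mem_head a s); apply.
  apply: wa0 (Aw _ (mem_head a s)) ts => i si.
  by rewrite Aw // inE si orbT.
by apply: free_s => i si; [apply: Aw | apply: w0]; rewrite inE si orbT.
Qed.

End Eigenvectors.

(** * The Bose-Mesner algebra as matrices depending only on distance *)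

Section DistanceMatrices.
Variables (R : realType) (X : finType) (e : rel X).
Hypotheses (e_conn : connected_graph e) (e_simple : simple_graph e).
Hypotheses (e_bip : bipartite_graph e) (e_dr : distance_regular e).
Local Notation C := R[i].
Local Notation n := #|X|.
Local Notation A := (adj_mx R e).

Lemma sum_enum_val (P : pred X) (g : X -> C) :
  \sum_(w : 'I_n | P (enum_val w)) g (enum_val w) = \sum_(w | P w) g w.
Proof.
rewrite [RHS](reindex_onto enum_val enum_rank) => [|w _]; last first.
  by rewrite enum_rankK.
by apply: eq_bigl => w; rewrite enum_valK eqxx andbT.
Qed.

(** When A F = t F for such a matrix F, the values of [f] on 0..D form a multiple of the cosine
    sequence of t. *)
Definition dist_fun_mx (f : nat -> C) : 'M[C]_n :=
  \matrix_(y, z) f (dist e (enum_val y) (enum_val z)).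

Lemma bose_mesnerP F : F \in bose_mesner R e -> exists f, F = dist_fun_mx f.
Proof.
pose s := in_tuple [seq dist_mx R e i | i <- iota 0 (diam e).+1].
rewrite -[bose_mesner R e]/(<<s>>%VS) => /coord_span ->.
exists (fun h => \sum_i coord s i F * (h == i :> nat)%:R).
apply/matrixP => y z; rewrite mxE summxE; apply: eq_bigr => i _.
have := ltn_ord i; rewrite [X in (_ < X)%N]size_map size_iota => iD.
by rewrite (nth_map 0%N) ?size_iota // nth_iota // !mxE.
Qed.

Lemma adj_mul_entry m (F : 'M[C]_(n, m)) y j :
  (A *m F) y j = \sum_(w | e (enum_val y) (enum_val w)) F w j.
Proof.
rewrite mxE [RHS]big_mkcond; apply: eq_bigr => w _.
by rewrite mxE dist1 //; case: e; rewrite ?mul1r ?mul0r.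
Qed.

Lemma adj_dist_fun_entry f y z :
  (A *m dist_fun_mx f) y z =
  \sum_(w | e (enum_val y) w) f (dist e w (enum_val z)).
Proof.
rewrite adj_mul_entry -(sum_enum_val (e _) (fun w => f (dist e w _))).
by apply: eq_bigr => w _; rewrite mxE.
Qed.

(** The diagonal entry at [x] gives the initial relation, and an entry at distance h+1 gives the
    recurrence. *)
Lemma eigen_cosine_rec (x : X) f t :
  A *m dist_fun_mx f = t *: dist_fun_mx f -> cosine_rec e t f.
Proof.
move=> Af; split=> [|h].
  have /matrixP/(_ (enum_rank x) (enum_rank x)) := Af.
  rewrite adj_dist_fun_entry !mxE !enum_rankK edge_sum0 // => ->.
  by congr (_ * f _); apply/eqP; rewrite dist0.
case/(dist_attained e_conn e_simple x) => y [z dyz].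
have /matrixP/(_ (enum_rank y) (enum_rank z)) := Af.
by rewrite adj_dist_fun_entry !mxE !enum_rankK (edge_sumS _ _ _ _ _ dyz) // dyz.
Qed.

Lemma dist_mxE i : dist_mx R e i = dist_fun_mx (fun h => (h == i)%:R).
Proof. by []. Qed.

(** These are the edge sums of the indicator function of i+1. *)
Lemma adj_mul_dist i :
  A *m dist_mx R e i.+1 =
  (bnum e i)%:R *: dist_mx R e i + (cnum e i.+2)%:R *: dist_mx R e i.+2.
Proof.
apply/matrixP => y z; rewrite dist_mxE adj_dist_fun_entry !mxE.
pose f h : C := (h == i.+1)%:R; rewrite -[LHS]/(\sum_(w | _) f (dist e w _)).
case dyz: (dist e (enum_val y) (enum_val z)) => [|h].
  move: dyz => /eqP; rewrite dist0 // => /eqP ->; rewrite edge_sum0 // mulr0 addr0 /f.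
  by rewrite eqSS; case: (i) => [|?]; rewrite ?mulr0.
rewrite (edge_sumS _ _ _ _ _ dyz) // /f !eqSS addrC; congr (_ + _).
  by rewrite eq_sym; case: eqP => [->|_]; rewrite ?mulr0.
by case: eqP => [->|_]; rewrite ?mulr0.
Qed.

Section Terwilliger.
Variable x : X.
Local Notation Talg := (@terwilliger_alg R X e x).

Lemma Talg_scale (a : C) B : Talg B -> Talg (a *: B).
Proof.
move=> TB; have T0 : Talg 0.
  have := Talg_lin (-1) (Talg_one R e x) (Talg_one R e x).
  by rewrite scaleN1r addNr.
by rewrite -[_ *: _]addr0; apply: Talg_lin.
Qed.

(** Since c_(i+2) is nonzero, the relation [adj_mul_dist] can be solved for A_(i+2), which expresses
    it through A and lower distance matrices. *)
Lemma Talg_dist i : (i <= diam e)%N -> Talg (dist_mx R e i).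
Proof.
elim/ltn_ind: i => -[_ _|[_ _|i IHi iD]]; [|exact: Talg_adj|].
  suff -> : dist_mx R e 0 = 1%:M by exact: Talg_one.
  by apply/matrixP => y z; rewrite !mxE dist0 // (inj_eq enum_val_inj).
have [_ c_gt0] := bnum_cnum_gt0 e_conn e_simple e_dr x iD.
have c_neq0 : (cnum e i.+2)%:R != 0 :> C by rewrite pnatr_eq0 -lt0n.
suff -> : dist_mx R e i.+2 = (cnum e i.+2)%:R^-1 *:
    (- (bnum e i)%:R *: dist_mx R e i + A *m dist_mx R e i.+1).
  apply/Talg_scale/Talg_lin; first by apply: IHi; lia.
  by apply: Talg_mul; [exact: Talg_adj | apply: IHi; lia].
by rewrite adj_mul_dist scaleNr addKr scalerK.
Qed.

Lemma dual_idem_entry i (w : 'cV[C]_n) y j :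
  (dual_idem R e x i *m w) y j = (dist e x (enum_val y) == i)%:R * w y j.
Proof. by rewrite mul_diag_mx !mxE. Qed.

Lemma sum_dual_idem : \sum_(i < (diam e).+1) dual_idem R e x i = 1%:M.
Proof.
apply/matrixP => y z; rewrite summxE.
pose h := Ordinal (dist_le_diam e x (enum_val y) : dist _ _ _ < (diam e).+1)%N.
rewrite (bigD1 h) //= big1 => [|i]; rewrite !mxE ?eqxx ?addr0 //.
by rewrite -val_eqE eq_sym => /negPf -> ; rewrite mul0rn.
Qed.

End Terwilliger.

(** * The spectrum of the adjacency matrix *)

Section Spectrum.

Lemma adj_sym y z : A y z = A z y.
Proof. by rewrite !mxE dist_sym. Qed.

(** [eigenvalue] speaks of row vectors; as A is symmetric, these amount to eigenfunctions on the
    vertices. *)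
Lemma eigenvalue_adjP t :
  eigenvalue A t <-> exists2 g : X -> C, exists y, g y != 0 &
    forall y, \sum_(w | e y w) g w = t * g y.
Proof.
have Ag (u : 'rV[C]_n) y :
    (u *m A) 0 (enum_rank y) = \sum_(w | e y w) u 0 (enum_rank w).
  rewrite -(sum_enum_val (e y) (fun w => u 0 (enum_rank w))) mxE.
  rewrite [RHS]big_mkcond; apply: eq_bigr => w _.
  rewrite adj_sym mxE enum_rankK dist1 // enum_valK.
  by case: e; rewrite ?mulr1 ?mulr0.
split=> [/eigenvalueP[u uA u0]|[g [y gy] Eg]].
  exists (fun y => u 0 (enum_rank y)) => [|y]; last by rewrite -Ag uA mxE.
  by have /rV0Pn[j uj] := u0; exists (enum_val j); rewrite enum_valK.
apply/eigenvalueP; exists (\row_w g (enum_val w)).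
  apply/rowP => w; rewrite -[w]enum_valK Ag !mxE enum_rankK -Eg.
  by apply: eq_bigr => z _; rewrite mxE enum_rankK.
apply/eqP => /rowP/(_ (enum_rank y)); rewrite !mxE enum_rankK => gy0.
by rewrite gy0 eqxx in gy.
Qed.

Lemma sum1_edge y : \sum_(w | e y w) (1 : C) = (valency e)%:R.
Proof. by rewrite (edge_sum0 _ _ _ (fun=> 1)) ?mulr1. Qed.

Lemma eigenvalue_valency (x : X) : eigenvalue A (valency e)%:R.
Proof.
apply/eigenvalue_adjP; exists (fun=> 1) => [|y]; first by exists x; rewrite oner_eq0.
by rewrite sum1_edge mulr1.
Qed.

(** Change the sign of an eigenfunction on one side of the bipartition. *)
Lemma eigenvalue_opp t : eigenvalue A t -> eigenvalue A (- t).
Proof.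
have [Y eY] := e_bip.
case/eigenvalue_adjP => g [y gy] Eg; apply/eigenvalue_adjP.
exists (fun w => (-1) ^+ (w \in Y) * g w) => [|z].
  by exists y; rewrite mulf_neq0 // signr_eq0.
rewrite mulNr mulrCA -Eg -mulNr mulr_sumr; apply: eq_bigr => w /eY.
by case: (z \in Y); case: (w \in Y) => //=; rewrite ?opprK.
Qed.

(** Let S be the sum of all |g z|. Summing |t g z| over z gives |t| S, and the triangle inequality
    bounds it by k S, since each |g w| is counted once for each of the k neighbours of [w]. *)
Lemma eigenvalue_le_valency t : eigenvalue A t -> `|t| <= (valency e)%:R.
Proof.
case/eigenvalue_adjP => g [y gy] Eg.
have S_gt0 : 0 < \sum_z `|g z|.
  by rewrite (bigD1 y) //= ltr_pwDl ?normr_gt0 // sumr_ge0.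
rewrite -(ler_pM2r S_gt0) !mulr_sumr.
apply: (@le_trans _ _ (\sum_z \sum_(w | e z w) `|g w|)).
  apply: ler_sum => z _; rewrite -normrM -Eg; exact: ler_norm_sum.
rewrite (exchange_big_dep xpredT) //=; apply: ler_sum => w _.
under eq_bigl do rewrite e_simple.1.
by rewrite -(sum1_edge w) mulr_suml; under [leRHS]eq_bigr do rewrite mul1r.
Qed.

End Spectrum.
End DistanceMatrices.

(* For t > b (t < b) only the hypothesis on t1 (td) is used, so the junk value
   0^-1 = 0 is harmless. *)
Lemma cosine_bound_gt0 (R : realFieldType) (b B t t1 td eta : R) :
  0 < B -> td <= t <= t1 ->
  - 1 - B * (t1 - b)^-1 < eta -> eta < - 1 - B * (td - b)^-1 ->
  0 < B + (1 + eta) * (t - b).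
Proof.
move=> B_gt0 /andP[tdt tt1] eta1 etad.
have [tb|bt|->] := ltgtP t b; last by rewrite subrr mulr0 addr0.
  have db : 0 < b - td by rewrite subr_gt0 (le_lt_trans tdt).
  have : (1 + eta) * (b - td) < B.
    rewrite -ltr_pdivlMr // -[b - td]opprB invrN; lra.
  by case: (lerP 0 (1 + eta)) => ?; nra.
have db : 0 < t1 - b by rewrite subr_gt0 (lt_le_trans bt).
have : - B < (1 + eta) * (t1 - b) by rewrite -ltr_pdivrMr // mulNr; lra.
by case: (lerP 0 (1 + eta)) => ?; nra.
Qed.

(** * Symmetry of the ordered spectrum *)

Section EigenvalueOrdering.
Variables (R : realType) (X : finType) (e : rel X).
Hypotheses (e_conn : connected_graph e) (e_simple : simple_graph e).
Hypotheses (e_bip : bipartite_graph e) (e_dr : distance_regular e).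
Variables (theta : nat -> R) (theta_ord : eigenvalue_ordering e theta) (x : X).
Local Notation D := (diam e).

Lemma theta_lt i j : (i < j <= D)%N -> theta j < theta i.
Proof. exact: theta_ord.1. Qed.

Lemma theta_le i j : (i <= j <= D)%N -> theta j <= theta i.
Proof.
by case/andP; case: ltngtP => // [ij _ jD|-> //]; rewrite ltW // theta_lt ?ij.
Qed.

Lemma theta_eigenvalue i : (i <= D)%N -> eigenvalue (adj_mx R e) (theta i)%:C.
Proof. by move=> iD; apply/theta_ord.2; exists i. Qed.

(** k is itself some theta_j, hence at most theta_0, while no eigenvalue exceeds k. *)
Lemma theta0 : theta 0%N = (valency e)%:R.
Proof.
have /theta_ord.2[j jD kE] := eigenvalue_valency R e_conn e_simple e_dr x.
have {}kE : (valency e)%:R = theta j by apply: complexI; rewrite -kE rmorph_nat.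
apply/eqP; rewrite eq_le {2}kE theta_le // andbT.
have := eigenvalue_le_valency e_conn e_simple e_dr (theta_eigenvalue (leq0n D)).
rewrite normc_def /= expr0n addr0 sqrtr_sqr -(rmorph_nat (real_complex R)) lecR.
exact/le_trans/ler_norm.
Qed.

Lemma theta_opp i : (i <= D)%N -> exists2 j, (j <= D)%N & theta j = - theta i.
Proof.
move=> /theta_eigenvalue/(eigenvalue_opp e_conn e_simple e_bip).
by case/theta_ord.2 => j jD jE; exists j => //; apply: complexI; rewrite -jE rmorphN.
Qed.

(** Negation permutes the spectrum and reverses its order. The induction [up] shows that -theta_i
    has index at most D - i, and [down] that it has index at least D - i. *)
Lemma theta_rev i : (i <= D)%N -> theta (D - i) = - theta i.
Proof.
have theta_ltE j k : (j <= D)%N -> (k <= D)%N -> theta j < theta k -> (k < j)%N.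
  move=> jD kD; case: (ltngtP k j) => // [jk|->]; last by rewrite ltxx.
  by move=> /ltW; rewrite leNgt theta_lt // jk.
have up k : (k <= D)%N -> exists2 j, (j <= D - k)%N & theta j = - theta k.
  elim: k => [|k IHk] kD.
    by have [j jD jE] := theta_opp (leq0n D); exists j; rewrite ?subn0.
  have [j jk jE] := IHk (ltnW kD); have [l lD lE] := theta_opp kD.
  have : (l < j)%N.
    by apply: theta_ltE; rewrite ?jE ?lE ?ltrN2 ?theta_lt ?ltnSn //; lia.
  by exists l => //; lia.
have down k : (k <= D)%N -> exists2 j, (k <= j <= D)%N & theta j = - theta (D - k).
  elim: k => [|k IHk] kD.
    by have [j jD jE] := theta_opp (leqnn D); exists j; rewrite ?subn0.
  have [j jk jE] := IHk (ltnW kD); have [l lD lE] := theta_opp (leq_subr k.+1 D).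
  have : (j < l)%N.
    by apply: theta_ltE; rewrite ?jE ?lE ?ltrN2 ?theta_lt //; lia.
  by exists l => //; lia.
move=> iD; apply/eqP; rewrite eq_le; apply/andP; split.
  by have [j jD <-] := up i iD; rewrite theta_le //; lia.
have [j jD jE] := down (D - i)%N (leq_subr _ _).
by rewrite subKn // in jE; rewrite -jE theta_le.
Qed.

(** The upper bounds hold because theta_i lies between theta_(D-1) = -theta_1 and theta_1, and
    theta_1 strictly between -k and k. For the lower bound, theta_d >= theta_(D-d) = -theta_d makes
    theta_d nonnegative, and either i <= d or i >= D - d. *)
Lemma theta_sqr_bounds i : (0 < i < D)%N ->
  [/\ theta D./2 ^+ 2 <= theta i ^+ 2, theta i ^+ 2 <= theta 1%N ^+ 2 &
      theta 1%N ^+ 2 < (valency e)%:R ^+ 2].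
Proof.
move=> iD; have revd := theta_rev (i := D./2) ltac:(lia).
have rev1 := theta_rev (i := 1) ltac:(lia); have rev0 := theta_rev (leq0n D).
split; last 1 first.
- have : theta 1%N < theta 0%N by rewrite theta_lt //; lia.
  have : theta (D - 0)%N < theta 1%N by rewrite theta_lt //; lia.
  by rewrite rev0 theta0; nra.
- have : theta D./2 >= theta (D - D./2)%N by rewrite theta_le //; lia.
  case: (leqP i D./2) => id.
    by have : theta i >= theta D./2; [rewrite theta_le //; lia | nra].
  by have : theta i <= theta (D - D./2)%N; [rewrite theta_le //; lia | nra].
have : theta i <= theta 1%N by rewrite theta_le //; lia.
have : theta (D - 1)%N <= theta i by rewrite theta_le //; lia.
by rewrite rev1; nra.
Qed.

End EigenvalueOrdering.

(** * Vectors supported at distance 2 from x with zero sum *)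

Section SecondSubconstituent.
Variables (R : realType) (X : finType) (e : rel X).
Hypotheses (e_conn : connected_graph e) (e_simple : simple_graph e).
Hypotheses (e_bip : bipartite_graph e) (e_dr : distance_regular e).
Variables (x : X) (v : 'cV[R[i]]_#|X|).
Hypothesis v_supp : forall z, v z 0 != 0 -> dist e x (enum_val z) = 2%N.
Hypothesis v_sum : \sum_z v z 0 = 0.

Lemma mul_dist_fun_const (f : nat -> R[i]) (a : R[i]) :
  (forall h, (h <= diam e)%N -> f h = a) -> dist_fun_mx e f *m v = 0.
Proof.
move=> fa; apply/colP => y; rewrite !mxE.
transitivity (a * \sum_z v z 0); last by rewrite v_sum mulr0.
rewrite mulr_sumr.
by apply: eq_bigr => z _; rewrite mxE fa // dist_le_diam.
Qed.

(** On the support of [v] the distance from [y] has the parity of the distance from [x] to [y], so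
    each row has constant sign there and gives a multiple of the zero sum. *)
Lemma mul_dist_fun_sign (f : nat -> R[i]) (a : R[i]) :
  (forall h, (h <= diam e)%N -> f h = (-1) ^+ h * a) ->
  dist_fun_mx e f *m v = 0.
Proof.
move=> fa; apply/colP => y; rewrite !mxE.
transitivity ((-1) ^+ dist e x (enum_val y) * a * \sum_z v z 0); last first.
  by rewrite v_sum mulr0.
rewrite mulr_sumr.
apply: eq_bigr => z _; have [->|/v_supp xz] := eqVneq (v z 0) 0.
  by rewrite !mulr0.
rewrite mxE fa ?dist_le_diam // -!(signr_odd _ (dist _ _ _)).
rewrite (odd_distD e_conn e_simple e_bip _ x) xz addbF.
by rewrite (dist_sym e_conn e_simple).
Qed.

Lemma mul_dist_fun_local (f : nat -> R[i]) (s : R[i]) y :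
  dist e x (enum_val y) = 2%N -> (dist_mx R e 2 *m v) y 0 = s * v y 0 ->
  (dist_fun_mx e f *m v) y 0 =
  (f 0%N + s * f 2%N - (1 + s) * f 4%N) * v y 0.
Proof.
move=> xy sv.
(* The coefficient of [f 4] is the entry of A_4 v, written as that of (J - A_0 - A_2) v with Jv =
   0. *)
transitivity (f 0%N * v y 0 + f 2%N * (dist_mx R e 2 *m v) y 0 +
  f 4%N * (\sum_z v z 0 - v y 0 - (dist_mx R e 2 *m v) y 0)); last first.
  by rewrite v_sum sv; ring.
have -> : v y 0 = \sum_z (dist e (enum_val y) (enum_val z) == 0%N)%:R * v z 0.
  rewrite (bigD1 y) //= dist0 // eqxx mul1r big1 ?addr0 // => z zy.
  by rewrite dist0 // (inj_eq enum_val_inj) eq_sym (negPf zy) mul0r.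
rewrite !mxE -!sumrB !mulr_sumr -!big_split; apply: eq_bigr => z _ /=.
have [->|/v_supp xz] := eqVneq (v z 0) 0; first by ring.
rewrite !mxE; set h := dist e (enum_val y) (enum_val z).
have : [|| h == 0, h == 2 | h == 4]%N.
  have := odd_distD e_conn e_simple e_bip (enum_val y) x (enum_val z).
  have := dist_triangle e_conn (enum_val y) x (enum_val z).
  by rewrite (dist_sym e_conn e_simple _ x) xy xz -/h; lia.
by case/or3P => /eqP ->; rewrite /=; ring.
Qed.

End SecondSubconstituent.

(** * Modules of the Terwilliger algebra *)

Section Modules.
Variables (R : realType) (X : finType) (e : rel X).
Hypotheses (e_conn : connected_graph e) (e_simple : simple_graph e).
Hypotheses (e_bip : bipartite_graph e) (e_dr : distance_regular e).
Variable x : X.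
Local Notation C := R[i].
Local Notation n := #|X|.
Local Notation D := (diam e).
Local Notation A := (adj_mx R e).

(** If [f 0] were zero, uniqueness for the recurrence would give f = 0 on 0..D and hence F = 0. *)
Lemma eigen_bose_mesner (t : C) F :
  F \in bose_mesner R e -> F != 0 -> A *m F = t *: F ->
  exists f, [/\ F = dist_fun_mx e f, cosine_rec e t f & f 0%N != 0].
Proof.
move=> /bose_mesnerP[f ->] F0 /(eigen_cosine_rec e_conn e_simple e_bip e_dr x) fP.
exists f; split=> //; apply: contraNneq F0 => f0.
have zeroP : cosine_rec e t (fun=> 0) by split=> [|h _]; rewrite !mulr0 ?addr0.
apply/eqP/matrixP => y z; rewrite !mxE.
by rewrite (cosine_rec_eq e_conn e_simple e_dr x fP zeroP f0) ?dist_le_diam.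
Qed.

Variable W : {vspace 'cV[C]_n}.
Hypothesis W_mod : T_module e x W.

Lemma bose_mesner_orbit_sub v :
  v \in W -> (bose_mesner_orbit e v <= W)%VS.
Proof.
move=> vW; apply/subvP => _ /memv_imgP[B BM ->]; rewrite lfunE /=.
have : (bose_mesner R e <= linfun (mulmxr v) @^-1: W)%VS.
  apply/span_subvP => _ /mapP[i + ->]; rewrite mem_iota => iD.
  rewrite -memv_preim lfunE /=; apply: W_mod vW.
  by apply: Talg_dist.
by move=> /subvP/(_ _ BM); rewrite -memv_preim lfunE.
Qed.

Lemma dual_part_sub i : (i <= D)%N -> (dual_part e x W i <= W)%VS.
Proof.
move=> iD; apply/subvP => _ /memv_imgP[w wW ->]; rewrite lfunE /=.
by apply: W_mod => //; apply: Talg_dual.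
Qed.

Lemma dual_part_entry i v z j :
  v \in dual_part e x W i -> v z j != 0 -> dist e x (enum_val z) = i.
Proof.
case/memv_imgP => w _ ->; rewrite lfunE /= dual_idem_entry.
by case: (_ =P i) => //; rewrite mul0r eqxx.
Qed.

(** The E*_i sum to the identity, so W lies in the sum of the E*_i W; these vanish for i < r and
    have dimension at most 1 for the D - r + 1 other indices. *)
Lemma dim_thin_le r : (r <= D)%N -> thin e x W -> has_endpoint e x W r ->
  (\dim W <= (D - r).+1)%N.
Proof.
move=> rD W_thin [_ _ W_end].
have sub : (W <= \sum_(i < D.+1) dual_part e x W i)%VS.
  apply/subvP => w wW; rewrite -[w]mul1mx -(sum_dual_idem R e x) mulmx_suml.
  apply: memv_suml => i _; apply: subvP (sumv_sup i _ (subvv _)) _ _ => //.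
  by rewrite -(lfunE (mulmx _)) memv_img.
apply: leq_trans (dimvS sub) (leq_trans (dimv_leq_sum _ _ _) _).
have -> : (D - r).+1 = (\sum_(i < D.+1) (r <= i))%N.
  rewrite -subSn //; elim: D.+1 => [|m IHm]; first by rewrite big_ord0.
  by rewrite big_ord_recr /= -IHm; lia.
apply: leq_sum => i _; case: (leqP r i) => [_|/W_end ->]; last by rewrite dimv0.
exact: W_thin (ltn_ord i).
Qed.

(** On the support of [v] the row of A_2 at [x] is constantly 1, so the sum is the [x] entry of E*_0
    A_2 v. *)
Lemma sum_endpoint2 v : (2 <= D)%N -> has_endpoint e x W 2 ->
  v \in dual_part e x W 2 -> \sum_z v z 0 = 0.
Proof.
move=> D2 [_ _ W_end] v2.
have vW := subvP (dual_part_sub D2) _ v2.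
have : dual_idem R e x 0 *m (dist_mx R e 2 *m v) \in dual_part e x W 0.
  by rewrite -(lfunE (mulmx _)) memv_img //; apply: W_mod vW; apply: Talg_dist.
rewrite W_end // memv0 => /eqP/colP/(_ (enum_rank x)).
rewrite dual_idem_entry enum_rankK dist0 // eqxx mul1r !mxE => sum0.
apply: etrans sum0; apply: eq_bigr => z _; rewrite mxE enum_rankK.
have [->|/(dual_part_entry v2) ->] := eqVneq (v z 0) 0; first by rewrite mulr0.
by rewrite mul1r.
Qed.

(** The right-hand E*_2 fixes [v], and the left-hand one preserves the entry at [y]. *)
Lemma local_eigenvalue_entry v eta y :
  v \in dual_part e x W 2 -> local_eigenvalue e x W eta ->
  dist e x (enum_val y) = 2%N ->
  (dist_mx R e 2 *m v) y 0 = eta%:C * v y 0.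
Proof.
move=> v2 W_eta xy; have /colP/(_ y) := W_eta v v2.
rewrite -!mulmxA dual_idem_entry xy mul1r [RHS]mxE => <-.
congr ((_ *m _) _ _); apply/colP => z; rewrite dual_idem_entry.
have [->|/(dual_part_entry v2) ->] := eqVneq (v z 0) 0; first by rewrite mulr0.
by rewrite mul1r.
Qed.

End Modules.

(** * The eigenbasis of W *)

Theorem theorem16p1 (R : realType) (X : finType) (e : rel X)
    (e_simple : simple_graph e) (e_conn : connected_graph e)
    (e_bip : bipartite_graph e) (e_dr : distance_regular e)
    (D_ge4 : (4 <= diam e)%N) (k_ge3 : (3 <= valency e)%N)
    (theta : nat -> R) (theta_ord : eigenvalue_ordering e theta)
    (E : nat -> 'M[R[i]]_#|X|)
    (E_prim : forall i : nat, (i <= diam e)%N ->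
       primitive_idempotent_for e (theta i) (E i))
    (x : X) (W : {vspace 'cV[R[i]]_#|X|})
    (W_irr : T_irreducible e x W) (W_thin : thin e x W)
    (W_endpoint : has_endpoint e x W 2)
    (eta : R) (W_eta : local_eigenvalue e x W eta)
    (eta_lb : theta_tilde e (theta 1%N) < eta)
    (eta_ub : eta < theta_tilde e (theta (diam e)./2))
    (v : 'cV[R[i]]_#|X|) (v_in : v \in dual_part e x W 2) (v_neq0 : v != 0) :
  [/\ W = bose_mesner_orbit e v,
      basis_of W [seq E i *m v | i <- iota 1 (diam e).-1],
      E 0%N *m v = 0 & E (diam e) *m v = 0].
Proof.
have [W_mod _ _] := W_irr; have D_ge2 := ltn_trans (isT : 1 < 3)%N D_ge4.
have v_supp z := dual_part_entry (z := z) (j := 0) v_in.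
have v_sum := sum_endpoint2 e_conn e_simple e_bip e_dr W_mod D_ge2 W_endpoint v_in.
have v_W := subvP (dual_part_sub W_mod D_ge2) _ v_in.
have EP i : (i <= diam e)%N -> exists f,
    [/\ E i = dist_fun_mx e f, cosine_rec e (theta i)%:C f & f 0%N != 0].
  move=> iD; have [[EM E0 _ _] AE] := E_prim i iD.
  exact: (eigen_bose_mesner e_conn e_simple e_bip e_dr x EM E0 AE).
have th0 := theta0 e_conn e_simple e_dr theta_ord x.
have E0v : E 0%N *m v = 0.
  have [f [-> fP _]] := EP 0%N isT; rewrite th0 rmorph_nat in fP.
  apply: (mul_dist_fun_const v_sum (a := f 0%N)).
  apply: (cosine_rec_eq e_conn e_simple e_dr x fP) => //.
  exact: (cosine_rec_const e_conn e_simple e_bip e_dr x).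
have EDv : E (diam e) *m v = 0.
  have [f [-> fP _]] := EP _ (leqnn _).
  have := theta_rev e_conn e_simple e_bip theta_ord (leq0n (diam e)).
  rewrite subn0 th0 => thD; rewrite thD rmorphN rmorph_nat in fP.
  apply: (mul_dist_fun_sign e_conn e_simple e_bip v_supp v_sum (a := f 0%N)).
  apply: (cosine_rec_eq e_conn e_simple e_dr x fP); last by rewrite mul1r.
  exact: (cosine_rec_sign e_conn e_simple e_bip e_dr x).
have Eiv i : (0 < i < diam e)%N -> E i *m v != 0.
  move=> iD; have [f [-> fP f0]] := EP i (ltnW (andP iD).2).
  (* At a vertex [y] of the support, the entry of E_i v is the local scalar times v_y, so it
     suffices that the scalar is nonzero. *)
  have /cV0Pn[y vy] := v_neq0; have xy := v_supp y vy.
  apply: contraTneq vy => /colP/(_ y).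
  rewrite (mul_dist_fun_local e_conn e_simple e_bip v_supp v_sum f xy
    (local_eigenvalue_entry v_in W_eta xy)) [RHS]mxE => /eqP.
  rewrite mulf_eq0 negbK => /orP[|//].
  have [] := theta_sqr_bounds e_conn e_simple e_bip e_dr theta_ord x iD.
  move=> thd th1 thk.
  have bb_gt0 : 0 < (bnum e 2)%:R * (bnum e 3)%:R :> R.
    have [b2 _] := bnum_cnum_gt0 e_conn e_simple e_dr x (ltnW D_ge4).
    have [b3 _] := bnum_cnum_gt0 e_conn e_simple e_dr x D_ge4.
    by rewrite mulr_gt0 ?ltr0n.
  have gap : theta (diam e)./2 ^+ 2 <= theta i ^+ 2 <= theta 1%N ^+ 2.
    by rewrite thd.
  have nz := cosine_bound_gt0 bb_gt0 gap eta_lb eta_ub.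
  (* As theta_i^2 <= theta_1^2 < k^2, the factor 1 - u_2 does not vanish. *)
  have tk : (theta i)%:C ^+ 2 != (valency e)%:R ^+ 2.
    rewrite -(rmorph_nat (real_complex R)) -!(rmorphXn (real_complex R)).
    rewrite (inj_eq (@complexI R)).
    by rewrite lt_eqF // (le_lt_trans th1).
  have nzC : (bnum e 2)%:R * (bnum e 3)%:R +
      (1 + eta%:C) * ((theta i)%:C ^+ 2 - (bnum e 2)%:R) != 0.
    rewrite (_ : _ + _ = ((bnum e 2)%:R * (bnum e 3)%:R +
        (1 + eta) * (theta i ^+ 2 - (bnum e 2)%:R))%:C).
      by rewrite -[0]/(0%:C) (inj_eq (@complexI R)) gt_eqF.
    by rewrite rmorphD !rmorphM rmorphB rmorphD rmorphXn !rmorph_nat rmorph1.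
  have := cosine_rec_local e_conn e_simple e_bip e_dr x D_ge4 fP f0 tk nzC.
  by move=> /negPf ->.
set s := [seq E i *m v | i <- iota 1 (diam e).-1].
have iotaP i : i \in iota 1 (diam e).-1 -> (0 < i < diam e)%N.
  by rewrite mem_iota; lia.
have s_free : free s.
  apply: (@free_eigen _ _ (adj_mx R e) _ (fun i => (theta i)%:C)).
  - move=> i /iotaP iD; rewrite mulmxA (E_prim i _).2 ?scalemxAl //; lia.
  - by move=> i /iotaP /Eiv.
  rewrite map_inj_in_uniq ?iota_uniq // => i j /iotaP iD /iotaP jD /complexI ij.
  case: (ltngtP i j) => // ltij.
    have /theta_ord.1 : (i < j <= diam e)%N by lia.
    by rewrite ij ltxx.
  have /theta_ord.1 : (j < i <= diam e)%N by lia.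
  by rewrite ij ltxx.
have s_orbit : (<<s>> <= bose_mesner_orbit e v)%VS.
  apply/span_subvP => _ /mapP[i /iotaP iD ->].
  have [[EM _ _ _] _] := E_prim i (ltnW (andP iD).2).
  by apply/memv_imgP; exists (E i); rewrite // lfunE.
have orbit_W := bose_mesner_orbit_sub e_conn e_simple e_bip e_dr W_mod v_W.
have dimW : (\dim W <= size s)%N.
  rewrite size_map size_iota.
  by apply: leq_trans (dim_thin_le D_ge2 W_thin W_endpoint) _; lia.
(* The span of [s] lies in Mv, hence in W, and the dimension bound makes both inclusions
   equalities. *)
have sW : <<s>>%VS = W.
  apply/eqP; rewrite eqEdim (subv_trans s_orbit) //=.
  by rewrite (eqP s_free).
split=> //; last by rewrite basisEfree s_free -sW subvv /= sW.
by apply/eqP; rewrite eqEsubv orbit_W andbT -sW.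
Qed.
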